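(* Let $d \geq 3$. Suppose a backbend sequence $\tilde{\beta}$ converges from below to a $k$-cyclic backbend sequence $\beta$ for some $k \in \mathbb{N}$. Then, for all $l \in \mathbb{N}$, all $e \in \{2, \ldots, d-1\}$, and all $p \in [0,1]$, we have $\theta^{\tilde{\beta}}_{\mathbb{Q}_l^e}(p) > 0$ if and only if $\theta^{\beta}_{\mathbb{Q}_l^e}(p) > 0$.
   Context: Let $\mathbb{Z}_+ = \mathbb{N}\cup\{0\}$. The $d$-dimensional body-centered cubic (BCC) lattice is the graph $(\mathbb{V},\mathbb{E})$ with vertex set $\mathbb{V} = \{x \in \mathbb{Z}^d : x_i \equiv x_j \ (\mathrm{mod}\ 2) \text{ for all } i,j\}$ and edge set $\mathbb{E}$ consisting of all unordered pairs $\langle x,y\rangle$ of vertices with $|x_1-y_1| = \cdots = |x_d-y_d| = 1$. Each edge is independently open with probability $p \in [0,1]$ and closed with probability $1-p$; $\mathbb{P}_p$ is the corresponding product measure. For $\widehat{\mathbb{V}} \subseteq \mathbb{V}$, a path in $\widehat{\mathbb{V}}$ is a sequence $x^0,\ldots,x^n$ of distinct vertices of $\widehat{\mathbb{V}}$ with $\langle x^i,x^{i+1}\rangle \in \mathbb{E}$; it is open if all its edges are open. The record level of a path $\pi = (x^0,\ldots,x^n)$ till $x^i$ is $h^i(\pi) = \max_{j \leq i} x^j_d$. A backbend sequence is a map $\beta : \mathbb{Z}_+ \to \mathbb{Z}_+\cup\{\infty\}$, with $\beta_i := \beta(i)$. For $x \in \widehat{\mathbb{V}}$ with $x_d \geq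 0$, a path $\pi = (x^0 = x,\ldots,x^n)$ in $\widehat{\mathbb{V}}$ is a $\beta$-backbend path in $\widehat{\mathbb{V}}$ from $x$ to $x^n$ if $x^i_d \geq h^i(\pi) - \beta_{h^i(\pi)}$ for every $i$. Let $C^{\beta}_{\widehat{\mathbb{V}}}$ be the random set of $x \in \widehat{\mathbb{V}}$ such that there is an open $\beta$-backbend path in $\widehat{\mathbb{V}}$ from the origin $(0,\ldots,0)$ to $x$. Put $\theta^{\beta}_{\widehat{\mathbb{V}}}(p) = \mathbb{P}_p(|C^{\beta}_{\widehat{\mathbb{V}}}| = \infty)$. A backbend sequence $\beta$ is $k$-cyclic ($k\in\mathbb{N}$) if for all $i \in \{0,\ldots,k-1\}$, $\beta_{kn+i} = \beta_i \in \mathbb{Z}_+$ for all $n \in \mathbb{N}$. A backbend sequence $\tilde\beta$ converges from below to a $k$-cyclic backbend sequence $\beta$ if for all $i \in \{0,\ldots,k-1\}$, $\lim_{n\to\infty}\tilde\beta_{kn+i} = \beta_i$ and $\tilde\beta_{kn+i} \leq \beta_i$ for all $n \in \mathbb{Z}_+$. For $l \in \mathbb{N}$ and $e \in \{2,\ldots,d\}$, the $e$-dimensional half-slab is $\mathbb{Q}_l^e = \{x \in \mathbb{V} : x \in [-l,l]^{d-e}\times\mathbb{Z}^{e-1}\times\mathbb{Z}_+\}$. *)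

(* Defs.v *)
From HB Require Import structures.
From mathcomp Require Import all_boot all_order all_algebra finmap.
From mathcomp Require Import all_classical all_reals all_analysis.

Set Implicit Arguments.
Unset Strict Implicit.
Unset Printing Implicit Defensive.

Import Order.TTheory GRing.Theory Num.Theory.

Local Open Scope fset_scope.
Local Open Scope classical_set_scope.
Local Open Scope ring_scope.

(* The dimension d is written n.+1, so that the distinguished last coordinate
   x_d is the one of index ord_max.  Coordinates are numbered from 0. *)
Notation lattice n := 'rV[int]_n.+1.

Definition height n (x : lattice n) : int := x ord0 ord_max.

Definition bcc n : set (lattice n) :=
  [set x | forall i j, (x ord0 i = x ord0 j %[mod 2])%Z].
Arguments bcc : clear implicits.

Definition bcc_adj n (x y : lattice n) : bool :=
  [forall i, `|x ord0 i - y ord0 i| == 1].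

Definition bcc_edges n : set {fset lattice n} :=
  [set e | exists x y, [/\ bcc n x, bcc n y, bcc_adj x y & e = [fset x; y]]].
Arguments bcc_edges : clear implicits.

Definition edge n : choiceType := set_type (bcc_edges n).

(* Configurations (true = open), with the product sigma-algebra, i.e. the one
   generated by the coordinate projections. *)
Definition config n :=
  g_sigma_algebraType (range (fun e : edge n => [set w : edge n -> bool | w e])).

(* The product of the Bernoulli(p) measures over the edges, characterized by its
   values on the finite-dimensional cylinders (a pi-system generating the
   sigma-algebra of config n, so there is exactly one such P). *)
Definition product_bernoulli (R : realType) n (p : R)
    (P : probability (config n) R) : Prop :=
  forall (F : {fset edge n}) (a : edge n -> bool),
    P [set w : config n | forall e, e \in F -> w e = a e] =
    (\prod_(e <- F) (if a e then p else 1 - p))%:E.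

Definition open_edge n (w : config n) (x y : lattice n) : bool :=
  `[< exists e : edge n, \val e = [fset x; y] /\ w e >].

(* A path x^0, ..., x^m is given by its first vertex x = x^0 and the sequence
   s = [:: x^1; ...; x^m]. *)
Definition is_path n (V : set (lattice n)) (x : lattice n)
    (s : seq (lattice n)) : Prop :=
  [/\ uniq (x :: s), forall y, y \in x :: s -> V y & path (@bcc_adj n) x s].

Definition open_path n (w : config n) (x : lattice n) (s : seq (lattice n)) :
  Prop := path (open_edge w) x s.

Definition record_level n (x : lattice n) (s : seq (lattice n)) (i : nat) :
  int := \big[Num.max/height x]_(y <- take i s) height y.

(* Z_+ with a point at infinity, None; the one-point compactification provides
   the usual topology, used below for limits. *)
Definition natbar := one_point_compactification nat.

Definition backbend_seq := nat -> natbar.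

Definition natbar_le (a b : natbar) : Prop :=
  match a, b with
  | _, None => True
  | None, Some _ => False
  | Some u, Some v => (u <= v)%N
  end.

(* When 0 <= height x the record levels are nonnegative, so that the absolute
   value below is only a conversion from int to nat. *)
Definition backbend_path n (b : backbend_seq) (V : set (lattice n))
    (x : lattice n) (s : seq (lattice n)) : Prop :=
  [/\ is_path V x s, 0 <= height x &
      forall i, (i <= size s)%N ->
        let h := record_level x s i in
        if b `|h|%N is Some m then h - m%:Z <= height (nth x (x :: s) i)
        else true].

Definition backbend_cluster n (b : backbend_seq) (V : set (lattice n)) (w : config n) :
  set (lattice n) :=
  [set y | exists s, [/\ backbend_path b V 0 s, open_path w 0 s &
                         last 0 s = y]].

Definition theta (R : realType) n (P : probability (config n) R)
    (b : backbend_seq) (V : set (lattice n)) : \bar R :=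
  P [set w : config n | infinite_set (backbend_cluster b V w)].

Definition cyclic_seq (k : nat) (b : backbend_seq) : Prop :=
  forall i, (i < k)%N ->
    b i <> None /\ forall m : nat, b (k * m + i)%N = b i.

Definition converges_from_below (k : nat) (bt b : backbend_seq) : Prop :=
  forall i, (i < k)%N ->
    (bt (k * m + i)%N @[m --> \oo] --> b i) /\
    forall m : nat, natbar_le (bt (k * m + i)%N) (b i).

(* Q_l^e for 2 <= e <= d = n.+1: the first d - e coordinates lie in [-l, l],
   the next e - 1 are free and the last one is nonnegative. *)
Definition half_slab n (l e : nat) : set (lattice n) :=
  [set x | [/\ bcc n x,
               forall i : 'I_n.+1, (i < n.+1 - e)%N -> `|x ord0 i| <= l%:Z &
               0 <= height x]].
Arguments half_slab : clear implicits.

(* Main.v *)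
Require Import Defs.
From mathcomp Require Import all_boot all_order all_algebra finmap.
From mathcomp Require Import all_classical all_reals all_analysis.
From mathcomp Require Import zify.

(** Why the theorem is true.  The limits b_i are finite and natbar is discrete
    away from its point at infinity, so convergence from below means two things:
    bt is everywhere at most b, and bt agrees with b from some level on.

    The first fact gives one direction at once: a bt-backbend path is a
    b-backbend path, so the cluster of bt is contained in that of b.

    For the other direction, choose an even multiple N of the period k beyond
    the last disagreement; by periodicity bt (N + m) = b m for every m
    ([converges_shift_eq]).  Climb from the origin to v = (0, ..., 0, N) along a
    zigzag that gains one level at each step.  The climb never steps back, so
    it is legal for every backbend sequence, and it keeps the lateral
    coordinates in {0, 1}, so it fits in the half-slab.  Above v, prepending
    the climb to the translate by v of a b-backbend path of the half-slab from
    the origin gives a bt-backbend path ([backbend_prepend_zigzag]): the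
    translate starts at its lowest possible level, and its record levels are
    those of the original path raised by N.  Thus bt percolates as soon as the
    N edges of the climb are open and the configuration seen from v
    percolates for b ([infinite_cluster_raise]).

    These two events depend on disjoint sets of edges, and the configuration
    seen from v has the law of the original one.  Both facts are obtained
    together, by relabelling edges with an injective map [raise_edge] that
    translates the edges of the upper half-space by v, fixes the others, and
    never hits the climb: [all_open_relabel_indep], proved by comparing two
    measures on the pi-system of the events that finitely many given edges are
    all open.  Hence the probability of percolation for bt is at least
    p ^ N times the one for b, which is positive when p > 0; for p = 0 both
    probabilities vanish ([theta_eq0]).  Monotonicity of P needs measurable
    events, whence [measurable_infinite_cluster]. *)

Set Implicit Arguments.
Unset Strict Implicit.
Unset Printing Implicit Defensive.

Import Order.TTheory GRing.Theory Num.Theory.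

Local Open Scope fset_scope.
Local Open Scope classical_set_scope.
Local Open Scope ring_scope.

(** * Measurability of percolation *)

Section Measurability.
Context (n : nat).
Implicit Types (w : config n) (V : set (lattice n)).

Lemma measurable_exists (T : countType) (F : T -> set (config n)) :
  (forall t, measurable (F t)) -> measurable [set w | exists t, F t w].
Proof.
move=> mF; rewrite (_ : [set w | _] = \bigcup_t F t).
  exact: countable_bigcupT_measurable.
by apply/seteqP; split => w [t]; [exists t | move=> _ ?; exists t].
Qed.

Lemma measurable_forall (T : countType) (F : T -> set (config n)) :
  (forall t, measurable (F t)) -> measurable [set w | forall t, F t w].
Proof.
move=> mF; rewrite (_ : [set w | _] = ~` [set w | exists t, (~` F t) w]).
  by apply: measurableC; apply: measurable_exists => t; apply: measurableC.
apply/seteqP; split => w /= Fw; first by case=> t; apply; exact: Fw.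
by move=> t; apply: contrapT => nF; apply: Fw; exists t.
Qed.

Lemma measurable_andl (Q : Prop) (F : set (config n)) :
  measurable F -> measurable [set w | Q /\ F w].
Proof.
move=> mF; have [q|nq] := pselect Q.
  by rewrite (_ : [set w | _] = F)//; apply/seteqP; split => w //= [].
by rewrite (_ : [set w | _] = set0)//; apply/seteqP; split => w //= [].
Qed.

Lemma measurable_edge_open (e : edge n) :
  measurable [set w : config n | w e].
Proof. by apply: sub_sigma_algebra; exists e. Qed.

(** [open_edge w x y] reads one coordinate of [w] when x and y are joined by an
    edge of the lattice, and is constantly false otherwise. *)
Lemma measurable_open_edge (x y : lattice n) :
  measurable [set w : config n | open_edge w x y].
Proof.
have [[e ee]|ne] := pselect (exists e : edge n, \val e = [fset x; y]).
  rewrite (_ : [set w | _] = [set w : config n | w e]).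
    exact: measurable_edge_open.
  apply/seteqP; split => w /=; last by move=> we; apply/asboolP; exists e.
  move=> /asboolP[e' [e'e we']]; rewrite (_ : e = e')//.
  by apply: val_inj; rewrite ee.
rewrite (_ : [set w | _] = set0)//; apply/seteqP; split => w //=.
by move=> /asboolP[e [ee _]]; apply: ne; exists e.
Qed.

Lemma measurable_open_path (x : lattice n) s :
  measurable [set w : config n | open_path w x s].
Proof.
rewrite /open_path; elim: s x => [|y s IHs] x /=.
  by rewrite (_ : [set w | _] = setT)//; apply/seteqP; split.
rewrite (_ : [set w | _] =
  [set w | open_edge w x y] `&` [set w | path (open_edge w) y s]).
  by apply: measurableI; [exact: measurable_open_edge|exact: IHs].
by apply/seteqP; split => w /=; [move=> /andP[]|move=> [-> ->]].
Qed.

(** For a countable [T] both quantifiers range over countable types, so that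
    being infinite becomes a countable combination of events. *)
Lemma infinite_setP (T : choiceType) (A : set T) :
  infinite_set A <-> forall X : {fset T}, exists y, ~~ (y \in X) /\ A y.
Proof.
split=> [iA X|AX /finite_fsetP[X AE]]; last first.
  by have [y [/negP yX]] := AX X; rewrite AE.
apply: contrapT => nex; apply: iA; apply: (@sub_finite_set _ _ [set` X]) => //.
by move=> y Ay; apply: contrapT => /negP yX; apply: nex; exists y.
Qed.

(** Whether a sequence of vertices is a backbend path is deterministic; only its
    being open depends on the configuration, through finitely many edges. *)
Lemma measurable_infinite_cluster (b : backbend_seq) V :
  measurable [set w : config n | infinite_set (backbend_cluster b V w)].
Proof.
rewrite (_ : [set w | _] = [set w : config n | forall X : {fset lattice n},
   exists y, ~~ (y \in X) /\ exists s,
   (backbend_path b V 0 s /\ last 0 s = y) /\ open_path w 0 s]).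
  apply: measurable_forall => X; apply: measurable_exists => y.
  apply: measurable_andl; apply: measurable_exists => s.
  by apply: measurable_andl; exact: measurable_open_path.
apply/seteqP; split => w /=.
  move=> /infinite_setP wX X; have [y [yX [s [? ? ?]]]] := wX X.
  by exists y; split => //; exists s.
move=> wX; apply/infinite_setP => X; have [y [yX [s [[? ?] ?]]]] := wX X.
by exists y; split => //; exists s.
Qed.

End Measurability.

(** * Injective relabelling of the edges *)

Section ProductMeasure.
Context (R : realType) (n : nat) (p : R) (P : probability (config n) R).
Hypothesis hP : product_bernoulli p P.

Definition all_open (F : {fset edge n}) : set (config n) :=
  [set w | forall e, e \in F -> w e].

Lemma measurable_all_open F : measurable (all_open F).
Proof.
apply: (@measurable_forall _ (edge n)
  (fun e => [set w : config n | e \in F -> w e])) => e.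
have [eF|eF] := boolP (e \in F).
  rewrite (_ : [set w | _] = [set w : config n | w e]).
    exact: measurable_edge_open.
  by apply/seteqP; split => w /=; [apply|].
by rewrite (_ : [set w | _] = setT)//; apply/seteqP; split.
Qed.

Lemma all_openE F :
  all_open F = [set w : config n | forall e, e \in F -> w e = true].
Proof. by apply/seteqP; split. Qed.

Lemma prob_all_open F : P (all_open F) = (p ^+ #|` F|)%:E.
Proof.
have := hP F (fun=> true); rewrite -all_openE => ->.
by rewrite big_const_seq count_predT iter_mulr_1.
Qed.

Lemma all_openI F G : all_open F `&` all_open G = all_open (F `|` G)%fset.
Proof.
apply/seteqP; split => w /=.
  by move=> [wF wG] e; rewrite inE => /orP[/wF|/wG].
by move=> wFG; split => e ein; apply: wFG; rewrite inE ein ?orbT.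
Qed.

Definition relabel (phi : edge n -> edge n) (w : config n) : config n :=
  w \o phi.

Lemma measurable_relabel phi : measurable_fun setT (relabel phi).
Proof.
apply: (@measurability _ _ (config n) (config n) setT (relabel phi)
  (range (fun e : edge n => [set w : edge n -> bool | w e]))) => //.
move=> _ [_ [e _ <-] <-]; rewrite setTI.
exact: (measurable_edge_open (phi e)).
Qed.

(** The events [all_open F] form a generating pi-system on which, unlike on general
    cylinders, intersection is just union of the edge sets. *)
Lemma measurable_config_all_open :
  @measurable _ (config n) = <<s range all_open >>.
Proof.
apply/seteqP; split.
  apply: smallest_sub; first exact: smallest_sigma_algebra.
  move=> _ [e _ <-]; apply: sub_sigma_algebra; exists [fset e] => //.
  apply/seteqP; split => w /=; first by apply; rewrite inE.
  by move=> we e'; rewrite inE => /eqP ->.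
apply: smallest_sub; first exact: sigma_algebra_measurable.
by move=> _ [F _ <-]; exact: measurable_all_open.
Qed.

(** Pulling configurations back along an injection that avoids [F] preserves the
    product law and gives a configuration independent of the edges in [F].  On
    the generating events both sides are a power of p, since the set F and the
    image of G are disjoint and their cardinals add up. *)
Lemma all_open_relabel_indep (phi : edge n -> edge n) (F : {fset edge n})
    (B : set (config n)) :
  injective phi -> (forall e, phi e \notin F) -> measurable B ->
  P (all_open F `&` relabel phi @^-1` B) = (P (all_open F) * P B)%E.
Proof.
move=> phi_inj phiF mB.
have p0 : 0 <= p ^+ #|` F|.
  by rewrite -lee_fin -prob_all_open; exact: measure_ge0.
transitivity (pushforward (mrestr P (measurable_all_open F)) (relabel phi) B).
  by rewrite /pushforward /mrestr setIC.
transitivity (mscale (NngNum p0) P B); last by rewrite prob_all_open.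
apply: (measure_unique (range all_open) (fun=> all_open fset0)).
- exact: measurable_config_all_open.
- by move=> _ _ [G _ <-] [H _ <-]; exists (G `|` H)%fset; rewrite ?all_openI.
- by move=> _; exists fset0.
- by apply/seteqP; split => // w _; exists 0%N => // e; rewrite inE.
- exact: measurable_relabel.
- move=> mphi _ [G _ <-].
  rewrite -[LHS]/(P (relabel phi @^-1` all_open G `&` all_open F)).
  rewrite -[RHS]/((p ^+ #|` F|)%:E * P (all_open G))%E.
  have -> : relabel phi @^-1` all_open G = all_open (phi @` G)%fset.
    apply/seteqP; split => w wG e; first by move=> /imfsetP[e' /= /wG ? ->].
    by move=> eG; apply: wG; apply/imfsetP; exists e.
  rewrite all_openI !prob_all_open -EFinM -exprD; congr (_ ^+ _)%:E.
  have -> : #|` G| = #|` (phi @` G)%fset| by rewrite card_imfset.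
  rewrite addnC; apply/eqP.
  rewrite (leq_card_fsetU _ _); apply/fdisjointP => e.
  by move=> /imfsetP[e' _ ->]; exact: phiF.
- move=> mphi k.
  have mI : measurable (relabel phi @^-1` all_open fset0 `&` all_open F).
    apply: measurableI; last exact: measurable_all_open.
    rewrite -[X in measurable X]setTI.
    exact: (measurable_relabel phi measurableT (measurable_all_open _)).
  exact: le_lt_trans (probability_le1 P mI) (ltry _).
- by [].
Qed.

End ProductMeasure.

(** * Record levels *)

Section Record.
Context (n : nat).
Implicit Types (x y : lattice n) (s : seq (lattice n)).

Lemma le_record_level x s i y :
  y \in x :: take i s -> height y <= record_level x s i.
Proof.
rewrite /record_level; elim: (take i s) => [|z t IHt].
  by rewrite inE big_nil => /eqP ->.
rewrite big_cons !inE le_max orbCA => /orP[/eqP ->|]; first by rewrite lexx.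
by move=> yt; rewrite IHt ?orbT// inE.
Qed.

Lemma record_level_attained x s i :
  exists2 y, y \in x :: take i s & record_level x s i = height y.
Proof.
rewrite /record_level; elim: (take i s) => [|z t [y yt IHt]].
  by exists x; rewrite ?inE ?eqxx ?big_nil.
rewrite big_cons; case: leP => _; last by exists z; rewrite ?inE ?eqxx ?orbT.
by exists y => //; move: yt; rewrite !inE => /orP[->|->]; rewrite ?orbT.
Qed.

Lemma record_levelE x s i h :
    (forall y, y \in x :: take i s -> height y <= h) ->
    (exists2 y, y \in x :: take i s & height y = h) ->
  record_level x s i = h.
Proof.
move=> ub [y yt yh]; apply/eqP; rewrite eq_le -{2}yh le_record_level// andbT.
by have [z zt ->] := record_level_attained x s i; exact: ub.
Qed.

Lemma le_record_start x s i : height x <= record_level x s i.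
Proof. by apply: le_record_level; rewrite inE eqxx. Qed.

End Record.

(** * The zigzag climb *)

Section Zigzag.
Context (n : nat).
Implicit Types (x y : lattice n) (s : seq (lattice n)).

(** All coordinates of a lattice vertex have the same parity, so a vertical climb
    has to oscillate laterally; at even levels it is back on the vertical axis. *)
Definition zigzag (i : nat) : lattice n :=
  \row_j (if j == ord_max then i%:Z else (odd i : nat)%:Z).

Lemma height_zigzag i : height (zigzag i) = i%:Z.
Proof. by rewrite /height mxE eqxx. Qed.

Lemma zigzag_inj : injective zigzag.
Proof. by move=> i j /(congr1 (@height n)); rewrite !height_zigzag => -[]. Qed.

Lemma zigzag0 : zigzag 0 = 0.
Proof. by apply/rowP => j; rewrite !mxE; case: ifP. Qed.

Lemma heightD x y : height (x + y) = height x + height y.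
Proof. by rewrite /height mxE. Qed.

Lemma bcc_zigzag i : bcc n (zigzag i).
Proof. by move=> j k; rewrite !mxE; do 2 case: ifP => _; lia. Qed.

Lemma bccD x y : bcc n x -> bcc n y -> bcc n (x + y).
Proof.
by move=> bx bY i j; rewrite !mxE -modzDm (bx i j) (bY i j) modzDm.
Qed.

Lemma adj_zigzag i : bcc_adj (zigzag i) (zigzag i.+1).
Proof. by apply/forallP => j; rewrite !mxE; case: ifP => _; lia. Qed.

Lemma bcc_adjD x y v : bcc_adj (x + v) (y + v) = bcc_adj x y.
Proof. by apply: eq_forallb => i; rewrite !mxE opprD addrACA subrr addr0. Qed.

Lemma half_slab_zigzag l e i : (0 < l)%N -> (2 <= e)%N ->
  half_slab n l e (zigzag i).
Proof.
move=> l0 e2; split; [exact: bcc_zigzag| |by rewrite height_zigzag].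
move=> j jle; rewrite mxE; case: eqP => [jm|_]; last by lia.
by move: jle; rewrite jm /=; lia.
Qed.

(** For even [i] the vector [zigzag i] is vertical, hence preserves the lateral
    bounds of the half-slab. *)
Lemma half_slabD_zigzag l e i x : ~~ odd i -> (2 <= e)%N ->
  half_slab n l e x -> half_slab n l e (x + zigzag i).
Proof.
move=> iev e2 [bx xl hx]; split.
- by apply: bccD => //; exact: bcc_zigzag.
- move=> j jle; rewrite mxE [zigzag i _ _]mxE.
  case: eqP => [jm|_]; last by rewrite (negbTE iev) addr0; exact: xl.
  by move: jle; rewrite jm /=; lia.
- by rewrite heightD height_zigzag addr_ge0.
Qed.

Definition zigzag_path N := [seq zigzag i | i <- iota 1 N].

Lemma size_zigzag_path N : size (zigzag_path N) = N.
Proof. by rewrite size_map size_iota. Qed.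

Lemma last_zigzag_path N : last 0 (zigzag_path N) = zigzag N.
Proof.
rewrite -nth_last size_zigzag_path; case: N => [|N]; first by rewrite zigzag0.
by rewrite (nth_map 0%N) ?size_iota// nth_iota.
Qed.

Lemma path_zigzag (r : rel (lattice n)) N :
  (forall i, (i < N)%N -> r (zigzag i) (zigzag i.+1)) ->
  path r 0 (zigzag_path N).
Proof.
move=> rN; apply/(pathP 0) => i; rewrite size_zigzag_path => iN.
have -> : nth 0 (zigzag_path N) i = zigzag i.+1.
  by rewrite (nth_map 0%N) ?size_iota ?nth_iota.
have -> : nth 0 (0 :: zigzag_path N) i = zigzag i.
  case: i iN => [|i] iN /=; first by rewrite zigzag0.
  by rewrite (nth_map 0%N) ?size_iota ?nth_iota//; lia.
exact: rN.
Qed.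

(** Counting the junction vertex [zigzag N] with the translated part makes the two
    parts disjoint: heights are below N in the first and at least N in the second. *)
Lemma cons_zigzag_cat N s :
  0 :: zigzag_path N ++ [seq y + zigzag N | y <- s] =
  [seq zigzag i | i <- iota 0 N] ++ [seq y + zigzag N | y <- 0 :: s].
Proof.
rewrite /= add0r -cat_rcons -map_rcons -cats1.
by rewrite -[[:: N]]/(iota (0 + N) 1) -iotaD addn1 -zigzag0.
Qed.

End Zigzag.

(** * Raising the edges of the upper half-space *)

Section Raise.
Context (n N : nat).
Implicit Types (x y : lattice n) (e : edge n) (w : config n).
Local Notation v := (zigzag n N).

Definition upper_edge e : bool :=
  `[< forall x, x \in \val e -> 0 <= height x >].

(** Translating every edge would send some edges below the origin onto the climb;
    leaving the edges outside the upper half-space in place avoids this and keeps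
    the map injective. *)
Definition raise_edge e : edge n :=
  if upper_edge e then insubd e [fset x + v | x in \val e] else e.

Lemma val_raise_edge e :
  upper_edge e -> \val (raise_edge e) = [fset x + v | x in \val e].
Proof.
move=> ue; rewrite /raise_edge ue; apply: insubdK.
have [x [y [bx bY xy ->]]] := set_valP e.
rewrite inE; exists (x + v), (y + v); split.
- by apply: bccD => //; exact: bcc_zigzag.
- by apply: bccD => //; exact: bcc_zigzag.
- by rewrite bcc_adjD.
- by rewrite imfsetU !imfset_fset1.
Qed.

Lemma upper_raise_edge e : upper_edge (raise_edge e) = upper_edge e.
Proof.
have [ue|/negbTE ue] := boolP (upper_edge e); last by rewrite /raise_edge ue.
apply/asboolP; rewrite val_raise_edge// => _ /imfsetP[x /= xe ->].
by rewrite heightD height_zigzag addr_ge0//; move/asboolP: ue; apply.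
Qed.

Lemma raise_edge_inj : injective raise_edge.
Proof.
move=> e f ef; have := upper_raise_edge e; rewrite ef upper_raise_edge => fe.
have [ue|/negbTE ue] := boolP (upper_edge e); last first.
  by move: ef; rewrite /raise_edge fe ue.
apply: val_inj; move/(congr1 val): ef; rewrite !val_raise_edge ?fe//.
move=> /fsetP ef; apply/fsetP => x; have := ef (x + v).
by rewrite !(mem_imfset _ _ (addIr v)).
Qed.

Lemma open_edge_raise w x y : 0 <= height x -> 0 <= height y ->
  open_edge (relabel raise_edge w) x y -> open_edge w (x + v) (y + v).
Proof.
move=> hx hy /asboolP[e [ee we]]; apply/asboolP; exists (raise_edge e); split => //.
rewrite val_raise_edge; first by rewrite ee imfsetU !imfset_fset1.
by apply/asboolP => z; rewrite ee !inE => /orP[]/eqP ->.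
Qed.

Lemma zigzag_edge_subproof i :
  [fset zigzag n i; zigzag n i.+1] \in bcc_edges n.
Proof.
rewrite inE; exists (zigzag n i), (zigzag n i.+1); split => //.
- exact: bcc_zigzag.
- exact: bcc_zigzag.
- exact: adj_zigzag.
Qed.

Definition zigzag_edge i : edge n :=
  exist (fun f => f \in bcc_edges n) _ (zigzag_edge_subproof i).

Definition zigzag_edges : {fset edge n} :=
  seq_fset tt [seq zigzag_edge i | i <- iota 0 N].

Lemma open_path_zigzag w :
  all_open zigzag_edges w -> open_path w 0 (zigzag_path n N).
Proof.
move=> wF; apply: path_zigzag => i iN; apply/asboolP.
exists (zigzag_edge i); split => //; apply: wF.
by rewrite seq_fsetE map_f// mem_iota.
Qed.

(** The lower endpoint of a climbing edge has a height in [0, N), whereas a raised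
    edge lies at height N or more and a fixed edge reaches below 0. *)
Lemma raise_edge_notin e : raise_edge e \notin zigzag_edges.
Proof.
rewrite seq_fsetE; apply/mapP => -[i]; rewrite mem_iota add0n => /andP[_ iN] eE.
have zi : zigzag n i \in \val (raise_edge e) by rewrite eE /= !inE eqxx.
have ue : upper_edge e.
  rewrite -upper_raise_edge eE; apply/asboolP => x.
  by rewrite /= !inE => /orP[]/eqP ->; rewrite height_zigzag.
move: zi; rewrite val_raise_edge// => /imfsetP[x /= xe].
move=> /(congr1 (@height n)); rewrite heightD !height_zigzag.
by have /asboolP/(_ x xe) := ue; lia.
Qed.

End Raise.

(** * Prepending the climb to a path *)

Section Prepend.
Context (n N : nat).
Implicit Types (x y : lattice n) (s : seq (lattice n)) (w : config n).
Local Notation v := (zigzag n N).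

Definition prepend_zigzag s := zigzag_path n N ++ [seq y + v | y <- s].

Lemma nth_prepend_zigzag s j : (j <= size s)%N ->
  nth 0 (0 :: prepend_zigzag s) (N + j) = nth 0 (0 :: s) j + v.
Proof.
move=> js; rewrite cons_zigzag_cat nth_cat size_map size_iota ltnNge leq_addr /=.
by rewrite addKn -[_ :: map _ s]/(map (+%R^~ v) (0 :: s)) (nth_map 0).
Qed.

Lemma nth_prepend_zigzag_lt s i : (i < N)%N ->
  nth 0 (0 :: prepend_zigzag s) i = zigzag n i.
Proof.
move=> iN; rewrite cons_zigzag_cat nth_cat size_map size_iota iN.
by rewrite (nth_map 0%N) ?size_iota// nth_iota.
Qed.

Lemma record_prepend_zigzag_lt s i : (i < N)%N ->
  record_level 0 (prepend_zigzag s) i = i%:Z.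
Proof.
move=> iN.
have E : 0 :: take i (prepend_zigzag s) = map (zigzag n) (iota 0 i.+1).
  rewrite take_cat size_zigzag_path iN -map_take take_iota (minn_idPl (ltnW iN)).
  by rewrite -zigzag0.
apply: record_levelE; rewrite E.
  by move=> _ /mapP[j + ->]; rewrite mem_iota height_zigzag; lia.
by exists (zigzag n i); rewrite ?height_zigzag// map_f// mem_iota leqnn.
Qed.

(** The climb stays below the starting level N of the translated part, so it does
    not contribute to the record. *)
Lemma record_prepend_zigzag s j : (j <= size s)%N ->
  record_level 0 (prepend_zigzag s) (N + j) = N%:Z + record_level 0 s j.
Proof.
move=> js.
have -> : record_level 0 (prepend_zigzag s) (N + j) =
          record_level 0 (prepend_zigzag (take j s)) (N + j).
  congr (\big[_/_]_(y <- _) _).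
  by rewrite !take_cat size_zigzag_path ltnNge leq_addr /= addKn map_take take_takel.
apply: record_levelE; rewrite take_oversize;
  rewrite ?size_cat ?size_map ?size_iota ?size_take.
- move=> y; rewrite cons_zigzag_cat mem_cat => /orP[]/mapP[].
    move=> i; rewrite mem_iota => iN ->; rewrite height_zigzag.
    by have := le_record_start 0 s j; rewrite /height mxE; lia.
  move=> z zs ->; rewrite heightD height_zigzag addrC lerD2l.
  exact: le_record_level.
- by case: ltnP => /=; lia.
- have [z zs ->] := record_level_attained 0 s j.
  exists (z + v); last by rewrite heightD height_zigzag addrC.
  by rewrite cons_zigzag_cat mem_cat orbC (map_f (+%R^~ v)).
- by case: ltnP => /=; lia.
Qed.

(** During the climb the current vertex is itself the record, so the constraint holds
    whatever [bt] is; afterwards the constraint at record level N + h is the one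
    imposed by [b] at level h. *)
Lemma backbend_prepend_zigzag (bt b : backbend_seq) l e w s :
    ~~ odd N -> (0 < l)%N -> (2 <= e)%N ->
    (forall m, bt (N + m)%N = b m) ->
    backbend_path b (half_slab n l e) 0 s ->
  backbend_path bt (half_slab n l e) 0 (prepend_zigzag s).
Proof.
move=> Nev l0 e2 bE [[us sV ads] h0 sb].
have hs y : y \in 0 :: s -> 0 <= height y by move=> /sV[].
split=> //.
  split.
  - rewrite cons_zigzag_cat cat_uniq (map_inj_uniq (@zigzag_inj n)) iota_uniq.
    rewrite (map_inj_uniq (addIr v)) us andbT.
    apply/hasPn => _ /mapP[y /hs hy ->]; apply/mapP => -[i].
    rewrite mem_iota => iN /(congr1 (@height n)).
    by rewrite heightD !height_zigzag; lia.
  - move=> y; rewrite cons_zigzag_cat mem_cat => /orP[]/mapP[].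
      by move=> i _ ->; exact: half_slab_zigzag.
    by move=> z /sV zV ->; exact: half_slabD_zigzag.
  - rewrite cat_path path_zigzag; last by move=> i _; exact: adj_zigzag.
    rewrite last_zigzag_path -{1}[zigzag n N]add0r.
    apply: (homo_path (f := +%R^~ v)) ads => x y.
    by rewrite bcc_adjD.
move=> i; rewrite size_cat size_zigzag_path size_map => iNs.
have [iN|Ni] := ltnP i N.
  rewrite nth_prepend_zigzag_lt// record_prepend_zigzag_lt// height_zigzag.
  by rewrite /=; case: (bt i) => [m|]; lia.
have js : (i - N <= size s)%N by lia.
have := sb _ js; rewrite -{3 4}(subnKC Ni) nth_prepend_zigzag//.
rewrite record_prepend_zigzag//; have := le_record_start 0 s (i - N).
rewrite (_ : height 0 = 0); last by rewrite /height mxE.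
case: (record_level _ _ _) => //= r _.
rewrite -PoszD /= bE; case: (b r) => //= m.
by rewrite heightD height_zigzag; lia.
Qed.

(** Translation by v injects the cluster of [b] in the relabelled configuration into
    the cluster of [bt]. *)
Lemma infinite_cluster_raise (bt b : backbend_seq) l e w :
    ~~ odd N -> (0 < l)%N -> (2 <= e)%N ->
    (forall m, bt (N + m)%N = b m) ->
    all_open (zigzag_edges n N) w ->
    infinite_set (backbend_cluster b (half_slab n l e)
      (relabel (@raise_edge n N) w)) ->
  infinite_set (backbend_cluster bt (half_slab n l e) w).
Proof.
move=> Nev l0 e2 bE wF; apply: contra_not => fin.
apply: (@sub_finite_set _ _
  ((fun y => y - v) @` backbend_cluster bt (half_slab n l e) w)); last first.
  exact: finite_image.
move=> y [s [sb so sy]]; exists (y + v); last by rewrite addrK.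
exists (prepend_zigzag s); split.
- exact: (@backbend_prepend_zigzag bt b).
- rewrite /open_path cat_path; apply/andP; split.
    exact: open_path_zigzag.
  rewrite last_zigzag_path -{1}[zigzag n N]add0r.
  have [[_ sV _] _ _] := sb.
  apply: (@homo_path_in _ _ [pred x | 0 <= height x] (+%R^~ v) _ _ _ _ _ _ so).
    by move=> x z hx hz; exact: open_edge_raise.
  by apply/allP => x /sV[].
- by rewrite last_cat last_zigzag_path -{1}[zigzag n N]add0r (last_map (+%R^~ v)) sy.
Qed.

End Prepend.

(** * Backbend sequences converging from below *)

Lemma natbar_nbhs_fin (m : nat) : nbhs (Some m : natbar) [set Some m].
Proof.
rewrite -[nbhs _]/(Some @ nbhs m).
apply: (@filterS _ (nbhs m) _ [set m]); last exact: discrete_set1.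
by move=> _ ->.
Qed.

Lemma converges_eventually_eq k (bt b : backbend_seq) :
    cyclic_seq k b -> converges_from_below k bt b ->
  \forall m \near \oo, forall i, (i < k)%N -> bt (k * m + i)%N = b i.
Proof.
move=> hb hbt.
have : \forall m \near \oo, forall i : 'I_k, bt (k * m + i)%N = b i.
  apply: filter_forall => i.
  have [+ _] := hb i (ltn_ord i); have [+ _] := hbt i (ltn_ord i).
  case bi : (b i) => [c|//] bc _.
  exact: (bc _ (@natbar_nbhs_fin c)).
apply: filterS => m H i ik; exact: (H (Ordinal ik)).
Qed.

(** An even multiple of the period is chosen, so that N is the height of a lattice
    point on the vertical axis. *)
Lemma converges_shift_eq k (bt b : backbend_seq) : (0 < k)%N ->
    cyclic_seq k b -> converges_from_below k bt b ->
  exists2 N, ~~ odd N & forall m, bt (N + m)%N = b m.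
Proof.
move=> k0 hb hbt.
have [q _ hq] := converges_eventually_eq hb hbt.
exists (k * q.*2)%N; first by rewrite oddM odd_double andbF.
move=> m; have mk : (m %% k < k)%N by rewrite ltn_mod.
have mE : m = (k * (m %/ k) + m %% k)%N by rewrite mulnC -divn_eq.
transitivity (b (m %% k)%N).
  rewrite {1}mE addnA -mulnDr hq//=.
  by rewrite -addnn -addnA leq_addr.
by rewrite [in RHS]mE; have [_ ->] := hb _ mk.
Qed.

Lemma converges_le k (bt b : backbend_seq) : (0 < k)%N ->
    cyclic_seq k b -> converges_from_below k bt b ->
  forall m, natbar_le (bt m) (b m).
Proof.
move=> k0 hb hbt m; have mk : (m %% k < k)%N by rewrite ltn_mod.
rewrite (divn_eq m k) (mulnC _ k); have [_ ->] := hb _ mk.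
by have [_] := hbt _ mk.
Qed.

(** * Comparison of the percolation probabilities *)

Section Clusters.
Context (n : nat).
Implicit Types (w : config n) (V : set (lattice n)).

Lemma backbend_cluster_le (bt b : backbend_seq) V w :
    (forall m, natbar_le (bt m) (b m)) ->
  backbend_cluster bt V w `<=` backbend_cluster b V w.
Proof.
move=> le_b y [s [[sP h0 sb] so sy]]; exists s; split => //; split => // i iN.
have := sb i iN; rewrite /=; have := le_b `|record_level 0 s i|%N.
case: (b _) => [c|//]; case: (bt _) => [a|//] /= ac; lia.
Qed.

Lemma infinite_cluster_open (b : backbend_seq) V w :
  infinite_set (backbend_cluster b V w) -> exists e : edge n, w e.
Proof.
move=> /infinite_setP/(_ [fset 0]%fset)[y [y0 [s [_ so sy]]]].
move: so sy y0; case: s => [_ <-|z s]; first by rewrite inE eqxx.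
by rewrite /open_path /= => /andP[/asboolP[e [_ we]] _] _ _; exists e.
Qed.

End Clusters.

Section Theta.
Context (R : realType) (n : nat) (p : R) (P : probability (config n) R).
Hypothesis hP : product_bernoulli p P.

(** At p = 0 almost surely no edge is open, the edges being countably many, and then
    the cluster contains at most the origin. *)
Lemma theta_eq0 b V : p = 0 -> theta P b V = 0%E.
Proof.
move=> p0; apply/negligibleP; first exact: measurable_infinite_cluster.
pose F k := if choice.unpickle k is Some e
             then [set w : config n | w (e : edge n)] else set0.
apply: (@negligibleS _ _ _ _ (\bigcup_k F k)).
  move=> w /infinite_cluster_open[e we].
  by exists (choice.pickle e) => //; rewrite /F choice.pickleK.
apply: negligible_bigcup => k; rewrite /F; case: choice.unpickle => [e|]; last first.
  exact: negligible_set0.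
apply/negligibleP; first exact: measurable_edge_open.
have -> : [set w : config n | w e] = all_open [fset e]%fset.
  apply/seteqP; split => w /=; last by apply; rewrite inE.
  by move=> we e'; rewrite inE => /eqP ->.
by apply: etrans (prob_all_open hP _) _; rewrite cardfs1 expr1 p0.
Qed.

Lemma theta_shift_gt0 (bt b : backbend_seq) N l e :
    0 <= p -> ~~ odd N -> (0 < l)%N -> (2 <= e)%N ->
    (forall m, bt (N + m)%N = b m) ->
  (0 < theta P b (half_slab n l e))%E -> (0 < theta P bt (half_slab n l e))%E.
Proof.
move=> p_ge0 Nev l0 e2 bE tb.
have p_gt0 : 0 < p.
  rewrite lt_neqAle p_ge0 andbT eq_sym; apply/eqP => p0.
  by rewrite (theta_eq0 _ _ p0) ltxx in tb.
pose I b' := [set w : config n |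
  infinite_set (backbend_cluster b' (half_slab n l e) w)].
have mI b' : measurable (I b') by exact: measurable_infinite_cluster.
apply: (@lt_le_trans _ _ (P (all_open (zigzag_edges n N) `&`
   relabel (@raise_edge n N) @^-1` I b))).
  rewrite (all_open_relabel_indep hP)//.
  - by rewrite (prob_all_open hP) mule_gt0// lte_fin exprn_gt0.
  - exact: raise_edge_inj.
  - exact: raise_edge_notin.
apply: le_measure; rewrite ?inE//.
  apply: measurableI; first exact: measurable_all_open.
  rewrite -[X in measurable X]setTI.
  exact: (measurable_relabel _ measurableT (mI b)).
  exact: (mI bt).
by move=> w [wF wI]; apply: (@infinite_cluster_raise n N bt b l e w).
Qed.

Lemma le_theta (bt b : backbend_seq) V : (forall m, natbar_le (bt m) (b m)) ->
  (theta P bt V <= theta P b V)%E.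
Proof.
move=> le_b; apply: le_measure; rewrite ?inE.
- exact: measurable_infinite_cluster.
- exact: measurable_infinite_cluster.
- move=> w /=; apply: contra_not; apply: sub_finite_set.
  exact: backbend_cluster_le.
Qed.

End Theta.

Theorem theorem3p4 (R : realType) (n : nat) (hd : (3 <= n.+1)%N)
    (k : nat) (hk : (0 < k)%N) (bt b : backbend_seq)
    (hb : cyclic_seq k b) (hbt : converges_from_below k bt b)
    (l : nat) (hl : (0 < l)%N) (e : nat) (he : (2 <= e <= n.+1 - 1)%N)
    (p : R) (hp : 0 <= p <= 1)
    (P : probability (config n) R) (hP : product_bernoulli p P) :
  (0 < theta P bt (half_slab n l e))%E <-> (0 < theta P b (half_slab n l e))%E.
Proof.
have [/andP[p0 _] /andP[e2 _]] := (hp, he); split.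
  by move=> /lt_le_trans; apply; apply: le_theta; exact: (converges_le hk).
have [N Nev bE] := converges_shift_eq hk hb hbt.
exact: (theta_shift_gt0 hP p0 Nev hl e2 bE).
Qed.
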